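(* Let $R$ be a unital ring and let $\alpha:R\to R$ be an injective ring homomorphism such that $\alpha(R)=eRe$ for some idempotent $e\in R$. Then the following two statements are equivalent: (1) The fractional skew monoid ring $R[t_+,t_-;\alpha]$ is simple. (2) The homomorphism $\alpha$ is outer and the only strongly $\alpha$-invariant ideals in $R$ are $\{0\}$ and $R$.
   Context: ''Ideal'' means two-sided ideal; a ring is simple if it is non-zero and has no ideals other than $\{0\}$ and itself. $\mathbb{N}=\{1,2,\dots\}$. Ring homomorphisms $R\to R$ are not required to preserve the unit; under the hypotheses $e=\alpha(1)$. The fractional skew monoid ring $R[t_+,t_-;\alpha]$ (of Ara, González-Barroso, Goodearl and Pardo) is the unital ring generated by a (unital) copy of $R$ and two elements $t_+,t_-$ subject to the relations $t_-t_+=1$, $t_+t_-=e$, $t_+r=\alpha(r)t_+$ and $rt_-=t_-\alpha(r)$ for all $r\in R$. For $n\in\mathbb{N}$, $\alpha$ is inner with periodicity $n$ if there are $u,v\in R$ with $vu=1$, and $\alpha^n(r)=urv$ and $\alpha(ur)=u\alpha(r)$ for all $r\in R$. (In general $u,v$ are taken in the multiplier ring $\mathcal{M}(R)$ of double centralizers of $R$, which equals $R$ as $R$ is unital.) $\alpha$ is outer if it is not inner with periodicity $n$ for any $n\in\mathbb{N}$. An ideal $I$ of $R$ is strongly $\alpha$-invariant if $\alpha(I)\subseteq I$ and $\alpha(R)I\alpha(R)\subseteq\alpha(I)$. *)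

(* Defs.v *)
From HB Require Import structures.
From mathcomp Require Import all_boot all_order all_algebra.
From mathcomp Require Import boolp classical_sets.

Set Implicit Arguments.
Unset Strict Implicit.
Unset Printing Implicit Defensive.

Import GRing.Theory.
Local Open Scope classical_set_scope.
Local Open Scope ring_scope.
Local Open Scope quotient_scope.

(* Rings are [pzRingType]s: unital, not necessarily commutative, and possibly
   zero.  A non-unital ring endomorphism is an additive map
   [alpha : {additive R -> R}] together with [{morph alpha : x y / x * y}]. *)

Section Ideals.
Variable R : pzRingType.

Definition two_sided_ideal (I : set R) : Prop :=
  [/\ I 0,
      forall x y, I x -> I y -> I (x + y),
      forall x, I x -> I (- x) &
      forall r x, I x -> I (r * x) /\ I (x * r)].

Definition simple_ring : Prop :=
  (exists x : R, x != 0) /\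
  forall I : set R, two_sided_ideal I -> I = [set 0] \/ I = [set: R].

(* The product of two subsets of a ring: all finite sums of products. *)
Definition mulset (A B : set R) : set R :=
  [set x | exists (k : nat) (a b : 'I_k -> R),
     [/\ forall i, A (a i), forall i, B (b i) & x = \sum_(i < k) a i * b i]].

Definition strongly_invariant (alpha : R -> R) (I : set R) : Prop :=
  alpha @` I `<=` I /\
  mulset (mulset (range alpha) I) (range alpha) `<=` alpha @` I.

(* [u] and [v] are taken in [R] itself, which is its own multiplier ring
   because it is unital. *)
Definition inner_with_periodicity (alpha : R -> R) (n : nat) : Prop :=
  exists u v : R,
    [/\ v * u = 1,
        forall r, iter n alpha r = u * r * v &
        forall r, alpha (u * r) = u * alpha r].

Definition outer (alpha : R -> R) : Prop :=
  forall n : nat, (0 < n)%N -> ~ inner_with_periodicity alpha n.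

End Ideals.

(* R[t+,t-;alpha] as a ring given by generators and relations: ring
   expressions over R and two letters, modulo the least congruence that
   contains the ring axioms, the ring operations of R (the constants 0 and 1
   being those of R) and the four defining relations. *)
Inductive fsm_term (R : Type) : Type :=
| FConst of R
| FTplus
| FTminus
| FAdd of fsm_term R & fsm_term R
| FOpp of fsm_term R
| FMul of fsm_term R & fsm_term R.

Arguments FTplus {R}.
Arguments FTminus {R}.

HB.instance Definition _ (R : Type) := gen_eqMixin (fsm_term R).
HB.instance Definition _ (R : Type) := gen_choiceMixin (fsm_term R).

Section FractionalSkewMonoidRing.
Variables (R : pzRingType) (alpha : R -> R) (e : R).
Implicit Types p q s : fsm_term R.

Inductive fsm_cong : fsm_term R -> fsm_term R -> Prop :=
| fsm_refl p : fsm_cong p p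
| fsm_sym p q : fsm_cong p q -> fsm_cong q p
| fsm_trans p q s : fsm_cong p q -> fsm_cong q s -> fsm_cong p s
| fsm_congD p p' q q' :
    fsm_cong p p' -> fsm_cong q q' -> fsm_cong (FAdd p q) (FAdd p' q')
| fsm_congN p p' : fsm_cong p p' -> fsm_cong (FOpp p) (FOpp p')
| fsm_congM p p' q q' :
    fsm_cong p p' -> fsm_cong q q' -> fsm_cong (FMul p q) (FMul p' q')
| fsm_addA p q s : fsm_cong (FAdd p (FAdd q s)) (FAdd (FAdd p q) s)
| fsm_addC p q : fsm_cong (FAdd p q) (FAdd q p)
| fsm_add0 p : fsm_cong (FAdd (FConst 0) p) p
| fsm_addN p : fsm_cong (FAdd (FOpp p) p) (FConst 0)
| fsm_mulA p q s : fsm_cong (FMul p (FMul q s)) (FMul (FMul p q) s)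
| fsm_mul1l p : fsm_cong (FMul (FConst 1) p) p
| fsm_mul1r p : fsm_cong (FMul p (FConst 1)) p
| fsm_mulDl p q s :
    fsm_cong (FMul (FAdd p q) s) (FAdd (FMul p s) (FMul q s))
| fsm_mulDr p q s :
    fsm_cong (FMul p (FAdd q s)) (FAdd (FMul p q) (FMul p s))
| fsm_constD x y : fsm_cong (FConst (x + y)) (FAdd (FConst x) (FConst y))
| fsm_constM x y : fsm_cong (FConst (x * y)) (FMul (FConst x) (FConst y))
| fsm_tmtp : fsm_cong (FMul FTminus FTplus) (FConst 1)
| fsm_tptm : fsm_cong (FMul FTplus FTminus) (FConst e)
| fsm_tpr r : fsm_cong (FMul FTplus (FConst r)) (FMul (FConst (alpha r)) FTplus)
| fsm_rtm r :
    fsm_cong (FMul (FConst r) FTminus) (FMul FTminus (FConst (alpha r))).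

Definition fsm_rel : rel (fsm_term R) := fun p q => `[< fsm_cong p q >].

Lemma fsm_rel_refl : reflexive fsm_rel.
Proof. by move=> p; apply/asboolP; apply: fsm_refl. Qed.

Lemma fsm_rel_sym : symmetric fsm_rel.
Proof. by move=> p q; apply/asboolP/asboolP; apply: fsm_sym. Qed.

Lemma fsm_rel_trans : transitive fsm_rel.
Proof.
move=> q p s /asboolP pq /asboolP qs.
by apply/asboolP; apply: fsm_trans pq qs.
Qed.

Canonical fsm_rel_equiv :=
  EquivRel fsm_rel fsm_rel_refl fsm_rel_sym fsm_rel_trans.

Definition fsm_ring : Type := {eq_quot fsm_rel}.

HB.instance Definition _ := Choice.on fsm_ring.
HB.instance Definition _ := EqQuotient.on fsm_ring.

Definition fsm_pi (p : fsm_term R) : fsm_ring := \pi_({eq_quot fsm_rel}) p.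

Lemma fsm_piP p q : fsm_pi p = fsm_pi q <-> fsm_cong p q.
Proof.
rewrite /fsm_pi; split=> [/eqquotP /asboolP //|H].
by apply/eqquotP/asboolP.
Qed.

Lemma fsm_piW (P : fsm_ring -> Prop) :
  (forall p, P (fsm_pi p)) -> forall x, P x.
Proof. by move=> H x; rewrite -[x]reprK; apply: H. Qed.

Lemma fsm_reprP p : fsm_cong (repr (fsm_pi p)) p.
Proof. by apply/fsm_piP; rewrite /fsm_pi reprK. Qed.

Definition fsm_add (x y : fsm_ring) := fsm_pi (FAdd (repr x) (repr y)).
Definition fsm_opp (x : fsm_ring) := fsm_pi (FOpp (repr x)).
Definition fsm_mul (x y : fsm_ring) := fsm_pi (FMul (repr x) (repr y)).

Lemma fsm_piD p q : fsm_add (fsm_pi p) (fsm_pi q) = fsm_pi (FAdd p q).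
Proof. by apply/fsm_piP; apply: fsm_congD; apply: fsm_reprP. Qed.

Lemma fsm_piN p : fsm_opp (fsm_pi p) = fsm_pi (FOpp p).
Proof. by apply/fsm_piP; apply: fsm_congN; apply: fsm_reprP. Qed.

Lemma fsm_piM p q : fsm_mul (fsm_pi p) (fsm_pi q) = fsm_pi (FMul p q).
Proof. by apply/fsm_piP; apply: fsm_congM; apply: fsm_reprP. Qed.

Fact fsm_ring_addA : associative fsm_add.
Proof.
elim/fsm_piW=> p; elim/fsm_piW=> q; elim/fsm_piW=> s.
by rewrite !fsm_piD; apply/fsm_piP; apply: fsm_addA.
Qed.

Fact fsm_ring_addC : commutative fsm_add.
Proof.
elim/fsm_piW=> p; elim/fsm_piW=> q.
by rewrite !fsm_piD; apply/fsm_piP; apply: fsm_addC.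
Qed.

Fact fsm_ring_add0 : left_id (fsm_pi (FConst 0)) fsm_add.
Proof. by elim/fsm_piW=> p; rewrite fsm_piD; apply/fsm_piP/fsm_add0. Qed.

Fact fsm_ring_addN : left_inverse (fsm_pi (FConst 0)) fsm_opp fsm_add.
Proof.
by elim/fsm_piW=> p; rewrite fsm_piN fsm_piD; apply/fsm_piP/fsm_addN.
Qed.

HB.instance Definition _ := GRing.isZmodule.Build fsm_ring
  fsm_ring_addA fsm_ring_addC fsm_ring_add0 fsm_ring_addN.

Fact fsm_ring_mulA : associative fsm_mul.
Proof.
elim/fsm_piW=> p; elim/fsm_piW=> q; elim/fsm_piW=> s.
by rewrite !fsm_piM; apply/fsm_piP; apply: fsm_mulA.
Qed.

Fact fsm_ring_mul1l : left_id (fsm_pi (FConst 1)) fsm_mul.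
Proof. by elim/fsm_piW=> p; rewrite fsm_piM; apply/fsm_piP/fsm_mul1l. Qed.

Fact fsm_ring_mul1r : right_id (fsm_pi (FConst 1)) fsm_mul.
Proof. by elim/fsm_piW=> p; rewrite fsm_piM; apply/fsm_piP/fsm_mul1r. Qed.

Fact fsm_ring_mulDl : left_distributive fsm_mul +%R.
Proof.
elim/fsm_piW=> p; elim/fsm_piW=> q; elim/fsm_piW=> s; rewrite /GRing.add /=.
by rewrite !(fsm_piM, fsm_piD); apply/fsm_piP; apply: fsm_mulDl.
Qed.

Fact fsm_ring_mulDr : right_distributive fsm_mul +%R.
Proof.
elim/fsm_piW=> p; elim/fsm_piW=> q; elim/fsm_piW=> s; rewrite /GRing.add /=.
by rewrite !(fsm_piM, fsm_piD); apply/fsm_piP; apply: fsm_mulDr.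
Qed.

HB.instance Definition _ := GRing.Zmodule_isPzRing.Build fsm_ring
  fsm_ring_mulA fsm_ring_mul1l fsm_ring_mul1r fsm_ring_mulDl fsm_ring_mulDr.

Definition fsm_const (r : R) : fsm_ring := fsm_pi (FConst r).
Definition fsm_tplus : fsm_ring := fsm_pi FTplus.
Definition fsm_tminus : fsm_ring := fsm_pi FTminus.

Lemma fsm_constD_eq x y : fsm_const (x + y) = fsm_const x + fsm_const y.
Proof.
by rewrite [RHS]fsm_piD; apply/fsm_piP; apply: fsm_constD.
Qed.

Lemma fsm_constM_eq x y : fsm_const (x * y) = fsm_const x * fsm_const y.
Proof.
by rewrite [RHS]fsm_piM; apply/fsm_piP; apply: fsm_constM.
Qed.

Lemma fsm_const1_eq : fsm_const 1 = 1.
Proof. by []. Qed.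

Lemma fsm_relations :
  [/\ fsm_tminus * fsm_tplus = 1,
      fsm_tplus * fsm_tminus = fsm_const e,
      forall r, fsm_tplus * fsm_const r = fsm_const (alpha r) * fsm_tplus &
      forall r, fsm_const r * fsm_tminus = fsm_tminus * fsm_const (alpha r)].
Proof.
split=> [||r|r]; rewrite [LHS]fsm_piM ?[RHS]fsm_piM; apply/fsm_piP.
- exact: fsm_tmtp.
- exact: fsm_tptm.
- exact: fsm_tpr.
- exact: fsm_rtm.
Qed.

(* Check of the construction: the universal property of the presentation. *)
Lemma fsm_universal (S : pzRingType) (f : {rmorphism R -> S}) (a b : S) :
  b * a = 1 -> a * b = f e ->
  (forall r, a * f r = f (alpha r) * a) ->
  (forall r, f r * b = b * f (alpha r)) ->
  let extends (g : {rmorphism fsm_ring -> S}) :=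
    [/\ forall r, g (fsm_const r) = f r, g fsm_tplus = a & g fsm_tminus = b] in
  exists2 g, extends g & forall h, extends h -> g =1 h.
Proof.
move=> ba ab ar rb extends.
pose ev := fix ev p : S := match p with
  | FConst r => f r | FTplus => a | FTminus => b
  | FAdd p q => ev p + ev q | FOpp p => - ev p | FMul p q => ev p * ev q end.
have evP p q : fsm_cong p q -> ev p = ev q.
  elim=> /= *; first [by [] | congruence | exact: addrC |
    by rewrite ?ba ?rmorph0 ?rmorph1 ?addrA ?add0r ?addNr ?mulrA ?mul1r ?mulr1
               ?mulrDl ?mulrDr ?rmorphD ?rmorphM].
pose g (x : fsm_ring) := ev (repr x).
have gpi p : g (fsm_pi p) = ev p by apply/evP/fsm_reprP.
have gB : zmod_morphism g.
  elim/fsm_piW=> p; elim/fsm_piW=> q.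
  have -> : fsm_pi p - fsm_pi q = fsm_pi (FAdd p (FOpp q)).
    by rewrite -fsm_piD -fsm_piN.
  by rewrite !gpi.
have gM : monoid_morphism g.
  split; first by rewrite [LHS]gpi /= rmorph1.
  elim/fsm_piW=> p; elim/fsm_piW=> q.
  have -> : fsm_pi p * fsm_pi q = fsm_pi (FMul p q) by rewrite -fsm_piM.
  by rewrite !gpi.
pose ga := GRing.isZmodMorphism.Build _ _ g gB.
pose gm := GRing.isMonoidMorphism.Build _ _ g gM.
pose G : {rmorphism fsm_ring -> S} := HB.pack g ga gm.
exists G => [|h [hR hp hm]].
  by split=> [r||]; rewrite [LHS]gpi.
elim/fsm_piW=> p; rewrite [LHS]gpi.
elim: p => [r|||p IHp q IHq|p IHp|p IHp q IHq] /=.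
- by rewrite -hR.
- by rewrite -hp.
- by rewrite -hm.
- by rewrite IHp IHq -rmorphD; congr (h _); exact: fsm_piD.
- by rewrite IHp -rmorphN; congr (h _); exact: fsm_piN.
- by rewrite IHp IHq -rmorphM; congr (h _); exact: fsm_piM.
Qed.

End FractionalSkewMonoidRing.

(* Main.v *)
Require Import Defs.
From HB Require Import structures.
From mathcomp Require Import all_boot all_order all_algebra.
From mathcomp Require Import boolp classical_sets.
From mathcomp Require Import zify.

Import GRing.Theory.
Local Open Scope classical_set_scope.
Local Open Scope ring_scope.

(** Write [t], [t'] for the two adjoined letters and [S] for the fractional skew
    monoid ring.  Since [alpha(R) = e R e], every [t' r t] lies in [R] again: it
    is [beta r], where [alpha (beta r) = e r e].  Hence every element of [S] is a
    finite sum of monomials [r t^n] and [t'^m r], and [S] is graded by the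
    integers with [t] in degree 1, [t'] in degree -1 and [R] as the component of
    degree 0.

    That the presentation neither collapses [R] nor mixes degrees has to be
    proved.  The terms are made to act on functions from the integers to [R] as
    they would by left multiplication on the coefficients of an element of [S];
    the action respects the defining congruence ([act_cong]).  Applied to the
    coefficients of 1 it defines [coef], from which come the projections [comp]
    on the homogeneous components ([comp_monom], [comp_eq0]) and their
    compatibility with homogeneous factors ([comp_homogeneousMl],
    [comp_homogeneousMr]).

    With the grading at hand the equivalence rests on two correspondences.
    An ideal of [R] is strongly invariant iff it is stable under [alpha] and
    [beta].  Thus the contraction to [R] of an ideal of [S] is strongly invariant
    ([contraction_ideal]), and the monomials with coefficients in a strongly
    invariant ideal [I] span an ideal of [S] whose contraction is [I]
    ([mspan_ideal], [mspan_const]).  On the other hand, [alpha] is inner with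
    periodicity [n] iff [S] has a central unit that is homogeneous of degree [n],
    namely [v t^n] with inverse [t'^n u] ([inner_central_unit],
    [central_unit_inner]).

    If [S] is simple, the first correspondence leaves only trivial strongly
    invariant ideals.  A central unit [z] of positive degree is impossible: [1 - z]
    would be zero or invertible, while the inverse would be the infinite geometric
    series in [z] ([simple_no_central_unit]).

    Conversely, suppose that [alpha] is outer and that the strongly invariant
    ideals are trivial, and let [J] be a nonzero ideal of [S].  Take elements of
    [J] of minimal support width, shifted to degrees [0 .. d].  Their lowest
    coefficients, taken together with 0, form a nonzero strongly invariant ideal,
    so some [y] in [J] has lowest component 1.  If [d = 0] then [y = 1].
    Otherwise [y r - r y] and [t' y t - y] have smaller width, so they vanish;
    hence the top component of [y] is central, and it is invertible because the
    ideal it generates contracts to a nonzero strongly invariant ideal of [R].  By the second correspondence [alpha] would be inner,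
    so [d = 0] and [J = S] ([nonzero_ideal_contains_1]). *)

(** * The constants as a ring morphism *)

Fact fsm_const_is_zmod_morphism (R : pzRingType) (alpha : R -> R) (e : R) :
  zmod_morphism (fsm_const alpha e).
Proof.
move=> x y; apply: (addIr (fsm_const alpha e y)).
by rewrite -fsm_constD_eq !subrK.
Qed.

HB.instance Definition _ (R : pzRingType) (alpha : R -> R) (e : R) :=
  GRing.isZmodMorphism.Build R (fsm_ring alpha e) (fsm_const alpha e)
    (fsm_const_is_zmod_morphism _ alpha e).

HB.instance Definition _ (R : pzRingType) (alpha : R -> R) (e : R) :=
  GRing.isMonoidMorphism.Build R (fsm_ring alpha e) (fsm_const alpha e)
    (fsm_const1_eq alpha e, fsm_constM_eq alpha e).

(** * The corner endomorphism and strongly invariant ideals *)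

Section CornerEndomorphism.

(** The corner idempotent is [alpha 1], and [beta] is compression to the corner
    followed by the inverse of [alpha]; it is not multiplicative in general. *)
Variables (R : pzRingType) (alpha : {additive R -> R}) (beta : R -> R).
Variables (alphaM : {morph alpha : x y / x * y}) (alpha_inj : injective alpha).
Variable (betaE : forall r, alpha (beta r) = alpha 1 * r * alpha 1).

Local Notation alphan n := (iter n alpha).
Local Notation e n := (iter n alpha 1).

Lemma iter_morphD n : {morph alphan n : x y / x + y}.
Proof. by elim: n => [|n IHn] x y //=; rewrite IHn raddfD. Qed.

Lemma iter_morphM n : {morph alphan n : x y / x * y}.
Proof. by elim: n => [|n IHn] x y //=; rewrite IHn alphaM. Qed.

Lemma iter_morph0 n : alphan n 0 = 0.
Proof. by elim: n => //= n ->; rewrite raddf0. Qed.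

Lemma mul_en n r : e n * alphan n r = alphan n r.
Proof. by rewrite -iter_morphM mul1r. Qed.

Lemma mulr_en n r : alphan n r * e n = alphan n r.
Proof. by rewrite -iter_morphM mulr1. Qed.

Lemma mul_enS n : e n.+1 * e n = e n.+1.
Proof. by rewrite iterSr mulr_en. Qed.

Lemma mul_eSn n : e n * e n.+1 = e n.+1.
Proof. by rewrite iterSr mul_en. Qed.

Lemma mul_e1 r : alpha 1 * alpha r = alpha r.
Proof. exact: (mul_en 1). Qed.

Lemma mulr_e1 r : alpha r * alpha 1 = alpha r.
Proof. exact: (mulr_en 1). Qed.

Lemma betaK : cancel alpha beta.
Proof. by move=> r; apply: alpha_inj; rewrite betaE mul_e1 mulr_e1. Qed.

Lemma betaD : {morph beta : x y / x + y}.
Proof.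
by move=> x y; apply: alpha_inj; rewrite raddfD !betaE mulrDr mulrDl.
Qed.

Lemma beta0 : beta 0 = 0.
Proof. by rewrite -{1}(raddf0 alpha) betaK. Qed.

(** Replaces the inclusion between sets of finite sums by a stability condition:
    an element of [alpha(R) I alpha(R)] is an [x] in [I] with [e x e = x], and
    then [x = alpha (beta x)]. *)
Lemma strongly_invariantP (I : set R) : two_sided_ideal I ->
  strongly_invariant alpha I <->
    (forall x, I x -> I (alpha x)) /\ (forall x, I x -> I (beta x)).
Proof.
move=> [I0 ID _ IM].
have Isum k (f : 'I_k -> R) : (forall i, I (f i)) -> I (\sum_(i < k) f i).
  by move=> If; apply: (big_ind I I0 ID) => i _; apply: If.
have mulset1 (A B : set R) a b : A a -> B b -> mulset A B (a * b).
  move=> Aa Bb; exists 1%N, (fun=> a), (fun=> b).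
  by split=> //; rewrite big_ord1.
split=> [[aI mI]|[aI bI]]; split=> x.
- by move=> Ix; apply: aI; exists x.
- move=> Ix; have [|y Iy yE] := mI (alpha 1 * x * alpha 1).
    by apply/mulset1; [apply/mulset1; [exists 1|]|exists 1].
  by rewrite -betaE in yE; rewrite -(alpha_inj _ _ yE).
- by move=> [y Iy <-]; apply: aI.
- move=> [k [a [b [aP bP xE]]]].
  have Ix : I x.
    rewrite xE; apply/Isum => i; apply: (IM _ _ _).2.
    have [l [c [d [_ dP ->]]]] := aP i; apply/Isum => j.
    exact: (IM _ _ (dP j)).1.
  exists (beta x); first exact: bI.
  rewrite betaE xE mulr_sumr mulr_suml; apply: eq_bigr => i _.
  have [l [c [d [cP _ ->]]]] := aP i; have [s _ <-] := bP i.
  rewrite -mulrA -mulrA mulr_e1 mulrA; congr (_ * _).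
  rewrite mulr_sumr; apply: eq_bigr => j _.
  by have [s' _ <-] := cP j; rewrite mulrA mul_e1.
Qed.

(** * The action on coefficient functions *)

Implicit Types f g : int -> R.

(** A function [f] stands for the formal sum of the [f n t^n] and of the
    [t'^m.+1 f (Negz m)].  The three operators are the effect on it of left
    multiplication by [c], [t] and [t']. *)
Definition act_const (c : R) f (k : int) : R :=
  match k with
  | Posz n => c * f (Posz n)
  | Negz m => alphan m.+1 c * f (Negz m)
  end.

Definition act_tplus f (k : int) : R :=
  match k with
  | Posz 0 => alpha 1 * f (Negz 0)
  | Posz n.+1 => alpha (f (Posz n))
  | Negz m => e m.+2 * f (Negz m.+1)
  end.

Definition act_tminus f (k : int) : R :=
  match k with
  | Posz n => beta (f (Posz n.+1))
  | Negz 0 => alpha 1 * f (Posz 0)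
  | Negz m.+1 => e m.+2 * f (Negz m)
  end.

Fixpoint act (p : fsm_term R) : (int -> R) -> int -> R :=
  match p with
  | FConst c => act_const c
  | FTplus => act_tplus
  | FTminus => act_tminus
  | FAdd p q => fun f => act p f \+ act q f
  | FOpp p => fun f => \- act p f
  | FMul p q => fun f => act p (act q f)
  end.

(** The monomial [r t^n] depends on [r] only through [r e_n], and [t'^m r] only
    through [e_m r].  The relations of the ring hold for the operators on the
    functions whose values are normalized accordingly, but not on all functions:
    the constant 1 multiplies the value at [Negz m] by [e_m.+1]. *)
Definition admissible f : Prop :=
  forall n, f (Posz n) * e n = f (Posz n) /\ e n.+1 * f (Negz n) = f (Negz n).

Lemma act_admissible p f : admissible f -> admissible (act p f).
Proof.
elim: p f => [c|||p IHp q IHq|p IHp|p IHp q IHq] f fA n /=.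
- split; first by rewrite -mulrA (fA n).1.
  by rewrite mulrA -!(iterS _ alpha) mul_en.
- split; last by rewrite mulrA -!(iterS _ alpha) mul_eSn.
  by case: n => [|n] /=; rewrite ?mulr1 // -alphaM (fA n).1.
- split; last first.
    by case: n => [|n]; rewrite /= mulrA ?mul_e1 // -!(iterS _ alpha) mul_en.
  apply: alpha_inj; rewrite alphaM betaE -!mulrA; congr (_ * _).
  rewrite mul_e1 -(fA n.+1).1 -[RHS]mulrA mulr_e1.
  by rewrite -mulrA -(iterS _ alpha) mulr_en.
- have [pP pN] := IHp f fA n; have [qP qN] := IHq f fA n.
  by rewrite mulrDl mulrDr pP pN qP qN.
- by have [pP pN] := IHp f fA n; rewrite mulNr mulrN pP pN.
- exact: (IHp _ (IHq _ fA)).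
Qed.

Lemma actD p f g : act p (f \+ g) = act p f \+ act p g.
Proof.
elim: p f g => [c|||p IHp q IHq|p IHp|p IHp q IHq] f g /=.
- by apply/funext=> -[n|n] /=; rewrite mulrDr.
- by apply/funext=> -[[|n]|n] /=; rewrite ?mulrDr ?raddfD.
- by apply/funext=> -[n|[|n]] /=; rewrite ?mulrDr ?betaD.
- by rewrite IHp IHq; apply/funext=> k /=; rewrite addrACA.
- by rewrite IHp; apply/funext=> k /=; rewrite opprD.
- by rewrite IHq IHp.
Qed.

(** The action is well defined on the ring; its faithfulness on the constants and
    the directness of the grading both come from this. *)
Lemma act_cong p q : fsm_cong alpha (alpha 1) p q ->
  forall f, admissible f -> act p f = act q f.
Proof.
elim=> {p q} /=.
- by [].
- by move=> p q _ IH f fA; rewrite IH.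
- by move=> p q s _ IHp _ IHq f fA; rewrite IHp ?IHq.
- by move=> p p' q q' _ IHp _ IHq f fA; rewrite IHp ?IHq.
- by move=> p p' _ IHp f fA; rewrite IHp.
- move=> p p' q q' _ IHp _ IHq f fA; rewrite IHq // IHp //.
  exact: act_admissible.
- by move=> p q s f _; apply/funext=> k /=; rewrite addrA.
- by move=> p q f _; apply/funext=> k /=; rewrite addrC.
- move=> p f _; apply/funext=> k /=.
  by case: k => n /=; rewrite -?(iterS _ alpha) ?iter_morph0 mul0r add0r.
- move=> p f _; apply/funext=> k /=; rewrite addNr.
  by case: k => n /=; rewrite -?(iterS _ alpha) ?iter_morph0 mul0r.
- by [].
- move=> p f fA; apply/funext=> -[n|n]; rewrite /= ?mul1r //.
  exact: (act_admissible p f fA n).2.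
- move=> p f fA; congr (act p _); apply/funext=> -[n|n]; rewrite /= ?mul1r //.
  exact: (fA n).2.
- by [].
- by move=> p q s f _; rewrite actD.
- move=> x y f _; apply/funext=> -[n|n] /=; first by rewrite mulrDl.
  by rewrite -!(iterS _ alpha) iter_morphD mulrDl.
- move=> x y f _; apply/funext=> -[n|n] /=; first by rewrite mulrA.
  by rewrite -!(iterS _ alpha) iter_morphM mulrA.
- move=> f fA; apply/funext=> -[n|[|n]] /=; rewrite ?mul1r ?betaK //.
    by rewrite mulrA mul_e1.
  by rewrite mulrA -!(iterS _ alpha) mul_en.
- move=> f fA; apply/funext=> -[[|n]|n] /=.
  + by rewrite mulrA mul_e1.
  + rewrite betaE -(fA n.+1).1 -!mulrA; congr (_ * (_ * _)).
    by rewrite /= mulr_e1.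
  + by rewrite mulrA -!(iterS _ alpha) mul_en -iterSr.
- move=> r f fA; apply/funext=> -[[|n]|n] /=.
  + by rewrite !mulrA mul_e1 mulr_e1.
  + by rewrite alphaM.
  + rewrite !mulrA -!(iterS _ alpha) -iterSr mul_en.
    by rewrite mulr_en.
- move=> r f fA; apply/funext=> -[n|[|n]] /=.
  + apply: alpha_inj; rewrite alphaM !betaE !mulrA mul_e1.
    by rewrite -[alpha r * _ * _]mulrA -mulrA -mulrA mulrA mulr_e1 mulrA.
  + by rewrite !mulrA mul_e1 mulr_e1.
  + rewrite -!(iterS _ alpha) !mulrA -iterSr mulr_en.
    by rewrite mul_en.
Qed.

(** * Monomials *)

Local Notation S := (fsm_ring alpha (alpha 1)).
Local Notation ringpi := (fsm_pi alpha (alpha 1)).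
Local Notation iota := (fsm_const alpha (alpha 1)).
Local Notation t := (fsm_tplus alpha (alpha 1)).
Local Notation t' := (fsm_tminus alpha (alpha 1)).

Lemma tminus_tplus : t' * t = 1.
Proof. by case: (fsm_relations alpha (alpha 1)). Qed.

Lemma tplus_tminus : t * t' = iota (alpha 1).
Proof. by case: (fsm_relations alpha (alpha 1)). Qed.

Lemma tplus_const r : t * iota r = iota (alpha r) * t.
Proof. by case: (fsm_relations alpha (alpha 1)). Qed.

Lemma const_tminus r : iota r * t' = t' * iota (alpha r).
Proof. by case: (fsm_relations alpha (alpha 1)). Qed.

Lemma const_e_tplus : iota (alpha 1) * t = t.
Proof. by rewrite -tplus_const rmorph1 mulr1. Qed.

Lemma tminus_const_e : t' * iota (alpha 1) = t'.
Proof. by rewrite -const_tminus rmorph1 mul1r. Qed.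

Lemma tplusX_const n r : t ^+ n * iota r = iota (alphan n r) * t ^+ n.
Proof.
elim: n => [|n IHn]; first by rewrite mul1r mulr1.
by rewrite exprS -mulrA IHn mulrA tplus_const -mulrA.
Qed.

Lemma const_tminusX n r : iota r * t' ^+ n = t' ^+ n * iota (alphan n r).
Proof.
elim: n => [|n IHn]; first by rewrite mul1r mulr1.
by rewrite exprSr mulrA IHn -mulrA const_tminus mulrA.
Qed.

Lemma tminusX_tplusX n : t' ^+ n * t ^+ n = 1.
Proof.
elim: n => [|n IHn]; first by rewrite mulr1.
by rewrite exprSr exprS mulrA -(mulrA _ t') tminus_tplus mulr1.
Qed.

Lemma tplusX_tminusX n : t ^+ n * t' ^+ n = iota (e n).
Proof.
elim: n => [|n IHn]; first by rewrite mulr1 rmorph1.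
rewrite exprSr exprS mulrA -(mulrA _ t) tplus_tminus tplusX_const -mulrA IHn.
by rewrite -rmorphM -iterSr mul_enS.
Qed.

(** The corner hypothesis enters the ring structure here: the subring of
    constants is closed under [x |-> t' x t], so that monomials of the two kinds
    suffice. *)
Lemma tminus_const_tplus r : t' * iota r * t = iota (beta r).
Proof.
have -> : t' * iota r * t = t' * iota (alpha 1 * r * alpha 1) * t.
  by rewrite !rmorphM !mulrA tminus_const_e -[RHS]mulrA const_e_tplus.
by rewrite -betaE -const_tminus -mulrA tminus_tplus mulr1.
Qed.

Definition monom (k : int) (r : R) : S :=
  match k with
  | Posz n => iota r * t ^+ n
  | Negz m => t' ^+ m.+1 * iota r
  end.

Lemma monom0r r : monom 0 r = iota r.
Proof. exact: mulr1. Qed.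

Lemma monomD k x y : monom k (x + y) = monom k x + monom k y.
Proof. by case: k => n /=; rewrite rmorphD ?mulrDl ?mulrDr. Qed.

Lemma monomN k x : monom k (- x) = - monom k x.
Proof. by case: k => n /=; rewrite rmorphN ?mulNr ?mulrN. Qed.

Lemma monom0 k : monom k 0 = 0.
Proof. by case: k => n /=; rewrite rmorph0 ?mul0r ?mulr0. Qed.

Lemma const_monom c k r : iota c * monom k r =
  monom k (if k is Negz m then alphan m.+1 c * r else c * r).
Proof.
case: k => [n|m]; rewrite /monom; first by rewrite rmorphM mulrA.
by rewrite mulrA const_tminusX rmorphM mulrA.
Qed.

Lemma tplus_monom k r : t * monom k r =
  monom (k + 1) (if k is Negz m then e m.+1 * r else alpha r).
Proof.
case: k => [n|[|m]]; rewrite /monom.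
- by rewrite mulrA tplus_const -mulrA -exprS addrC.
- by rewrite expr1 mulrA tplus_tminus -rmorphM; apply/esym/mulr1.
- have -> : Negz m.+1 + 1 = Negz m by lia.
  rewrite exprS !mulrA tplus_tminus const_tminusX -mulrA -rmorphM.
  by rewrite -iterSr.
Qed.

Lemma tminus_monom k r : t' * monom k r =
  monom (k - 1) (if k is Posz n.+1 then beta r else r).
Proof.
case: k => [[|n]|m]; rewrite /monom.
- by rewrite mulr1.
- have -> : Posz n.+1 - 1 = Posz n by lia.
  by rewrite exprS !mulrA tminus_const_tplus.
- have -> : Negz m - 1 = Negz m.+1 by lia.
  by rewrite mulrA -exprS.
Qed.

Lemma monom_const k r c : monom k r * iota c =
  monom k (if k is Posz n then r * alphan n c else r * c).
Proof.
case: k => [n|m]; rewrite /monom; last by rewrite rmorphM mulrA.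
by rewrite -mulrA tplusX_const rmorphM mulrA.
Qed.

Lemma monom_tplus k r : monom k r * t =
  monom (k + 1) (if k is Negz _ then beta r else r).
Proof.
case: k => [n|m]; rewrite /monom.
- by rewrite -mulrA -exprSr addrC.
- have -> : t' ^+ m.+1 * iota r * t = t' ^+ m * iota (beta r).
    by rewrite exprSr -!mulrA [t' * _]mulrA tminus_const_tplus.
  case: m => [|m]; first by rewrite mul1r; apply/esym/mulr1.
  by have -> : Negz m.+1 + 1 = Negz m by lia.
Qed.

Lemma monom_tminus k r : monom k r * t' =
  monom (k - 1) (if k is Posz n.+1 then r * e n.+1 else alpha r).
Proof.
case: k => [[|n]|m]; rewrite /monom.
- by rewrite mulr1 const_tminus.
- have -> : Posz n.+1 - 1 = Posz n by lia.
  by rewrite exprSr -!mulrA tplus_tminus tplusX_const mulrA -rmorphM -iterSr.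
- have -> : Negz m - 1 = Negz m.+1 by lia.
  by rewrite -mulrA const_tminus mulrA -exprSr.
Qed.

(** * Coefficients and homogeneous components *)

Definition single (k : int) (r : R) (j : int) : R := if j == k then r else 0.

(** The formal sum of degree 0 with coefficient 1 stands for the unit, so that [x]
    carries it to the normalized coefficients of [x]. *)
Definition coef (x : S) : int -> R := act (repr x) (single 0 1).

Lemma coef_pi p : coef (ringpi p) = act p (single 0 1).
Proof.
apply: act_cong; first exact: fsm_reprP.
by case=> [|n]; rewrite /single /= ?mulr1 ?mul0r ?mulr0.
Qed.

Lemma coef_piM p x : coef (ringpi p * x) = act p (coef x).
Proof.
elim/fsm_piW: x => q; have -> : ringpi p * ringpi q = ringpi (FMul p q).
  exact: fsm_piM.
by rewrite !coef_pi.
Qed.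

Lemma coefD x y k : coef (x + y) k = coef x k + coef y k.
Proof.
elim/fsm_piW: x => p; elim/fsm_piW: y => q.
have -> : ringpi p + ringpi q = ringpi (FAdd p q) by exact: fsm_piD.
by rewrite !coef_pi.
Qed.

Lemma coef0 k : coef 0 k = 0.
Proof. by apply: (addrI (coef 0 k)); rewrite -coefD !addr0. Qed.

Lemma coef_const r : coef (iota r) = single 0 r.
Proof.
rewrite coef_pi; apply/funext=> -[[|n]|n]; rewrite /single /= ?mulr1 ?mulr0 //.
Qed.

(** The normalized coefficient of a monomial. *)
Definition trunc (k : int) (r : R) : R :=
  match k with Posz n => r * e n | Negz m => e m.+1 * r end.

Lemma coef_monom k r : coef (monom k r) = single k (trunc k r).
Proof.
case: k => [n|m]; rewrite /monom /trunc.
  have coef_tX : coef (t ^+ n) = single n (e n).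
    elim: n => [|n IHn]; first exact: coef_const.
    rewrite exprS coef_piM IHn; apply/funext=> -[[|j]|j];
      rewrite /single /= ?mulr0 //.
    by rewrite !eqz_nat eqSS; case: eqP; rewrite ?raddf0.
  rewrite coef_piM coef_tX; apply/funext=> -[j|j]; rewrite /single /= ?mulr0 //.
  by case: eqP; rewrite ?mulr0.
elim: m => [|m IHm].
  rewrite expr1 coef_piM coef_const; apply/funext=> -[j|[|j]];
    by rewrite /single /= ?beta0 ?mulr0.
rewrite exprS -mulrA coef_piM IHm; apply/funext=> -[j|[|j]];
  rewrite /single /= ?beta0 ?mulr0 //.
have -> : (Negz j.+1 == Negz m.+1) = (Negz j == Negz m) by lia.
case: eqP => [[->]|_]; last by rewrite mulr0.
by rewrite -!(iterS _ alpha) mulrA mul_enS.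
Qed.

Lemma monom_trunc k r : monom k (trunc k r) = monom k r.
Proof.
case: k => n /=; rewrite rmorphM.
  by rewrite -mulrA -tplusX_const rmorph1 mulr1.
by rewrite mulrA -(iterS _ alpha) -const_tminusX rmorph1 mul1r.
Qed.

Definition comp (k : int) (x : S) : S := monom k (coef x k).

Lemma compD k x y : comp k (x + y) = comp k x + comp k y.
Proof. by rewrite /comp coefD monomD. Qed.

Lemma comp_monom k j r : comp k (monom j r) = if k == j then monom j r else 0.
Proof.
rewrite /comp coef_monom /single; case: eqP => [->|_]; last exact: monom0.
exact: monom_trunc.
Qed.

Lemma comp0 k : comp k 0 = 0.
Proof. by rewrite -(monom0 0) comp_monom monom0; case: ifP. Qed.

Lemma compN k x : comp k (- x) = - comp k x.
Proof. by apply/eqP; rewrite -addr_eq0 -compD addNr comp0. Qed.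

Lemma const_inj : injective iota.
Proof.
move=> x y xy; have := congr1 (fun z => coef z 0) xy.
by rewrite !coef_const.
Qed.

Definition homogeneous (k : int) (x : S) : Prop := exists r, x = monom k r.

Lemma comp_homogeneous k x : homogeneous k (comp k x).
Proof. by exists (coef x k). Qed.

Lemma homogeneous_comp j k x : homogeneous j x ->
  comp k x = if k == j then x else 0.
Proof. by move=> [r ->]; apply: comp_monom. Qed.

Lemma homogeneous_const r : homogeneous 0 (iota r).
Proof. by exists r; rewrite monom0r. Qed.

Lemma homogeneousM j k x y : homogeneous j x -> homogeneous k y ->
  homogeneous (j + k) (x * y).
Proof.
have homc a l z : homogeneous l z -> homogeneous l (iota a * z).
  by move=> [r ->]; rewrite const_monom; eexists.
have homt l z : homogeneous l z -> homogeneous (l + 1) (t * z).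
  by move=> [r ->]; rewrite tplus_monom; eexists.
have homt' l z : homogeneous l z -> homogeneous (l - 1) (t' * z).
  by move=> [r ->]; rewrite tminus_monom; eexists.
move=> [r ->] yk; case: j => [n|m].
  rewrite /monom -mulrA; apply: homc.
  elim: n => [|n IHn]; first by rewrite mul1r add0r.
  rewrite exprS -mulrA; have -> : Posz n.+1 + k = Posz n + k + 1 by lia.
  exact: homt.
rewrite /monom -mulrA; have {}yk := homc r _ _ yk; move: yk.
move: (iota r * y) => {}y yk; elim: m => [|m IHm].
  by rewrite expr1 addrC; apply: homt'.
rewrite exprS -mulrA; have -> : Negz m.+1 + k = Negz m + k - 1 by lia.
exact: homt'.
Qed.

(** The additive subgroup spanned by the monomials with coefficients in [I] is
    described by finite sums, which yields at once an induction principle and the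
    finiteness of the supports. *)
Definition mspan (I : set R) (x : S) : Prop :=
  exists2 s : seq (int * R), (forall kr, kr \in s -> I kr.2) &
    x = \sum_(kr <- s) monom kr.1 kr.2.

Lemma mspan0 I : mspan I 0.
Proof. by exists [::]; rewrite ?big_nil. Qed.

Lemma mspanD I x y : mspan I x -> mspan I y -> mspan I (x + y).
Proof.
move=> [s1 s1I ->] [s2 s2I ->]; exists (s1 ++ s2); last by rewrite big_cat.
by move=> kr; rewrite mem_cat => /orP[/s1I|/s2I].
Qed.

Lemma mspan_monom (I : set R) k r : I r -> mspan I (monom k r).
Proof.
move=> Ir; exists [:: (k, r)]; last by rewrite big_seq1.
by move=> kr; rewrite inE => /eqP->.
Qed.

Lemma mspan_ind (I : set R) (P : S -> Prop) :
  P 0 -> (forall x y, P x -> P y -> P (x + y)) ->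
  (forall k r, I r -> P (monom k r)) -> forall x, mspan I x -> P x.
Proof.
move=> P0 PD Pm x [s sI ->]; rewrite big_seq.
by apply: (big_ind P) => // kr /sI; apply: Pm.
Qed.

Lemma mspan_additive (I : set R) (phi : S -> S) :
  phi 0 = 0 -> {morph phi : x y / x + y} ->
  (forall k r, I r -> mspan I (phi (monom k r))) ->
  forall x, mspan I x -> mspan I (phi x).
Proof.
move=> phi0 phiD phim; apply: mspan_ind => //.
  by rewrite phi0; apply: mspan0.
by move=> x y; rewrite phiD; apply: mspanD.
Qed.

Lemma mspanN (I : set R) x : (forall r, I r -> I (- r)) ->
  mspan I x -> mspan I (- x).
Proof.
move=> IN; apply: mspan_additive => [|y z|k r Ir]; rewrite ?oppr0 ?opprD //.
by rewrite -monomN; apply/mspan_monom/IN.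
Qed.

(** A product of a generator and a monomial is a monomial, with the same
    coefficient or with one obtained from it by [alpha], [beta] or a
    multiplication in [R]; so [I] need only be stable under these. *)
Lemma mspan_ideal (I : set R) : two_sided_ideal I ->
  (forall x, I x -> I (alpha x)) -> (forall x, I x -> I (beta x)) ->
  two_sided_ideal (mspan I).
Proof.
move=> [I0 ID IN IM] Ia Ib.
have IMl c x : I x -> I (c * x) by move=> /(IM c)[].
have IMr c x : I x -> I (x * c) by move=> /(IM c)[].
split; [exact: mspan0|exact: mspanD|by move=> x; apply: mspanN|].
have mulpD p q : ringpi (FAdd p q) = ringpi p + ringpi q.
  by rewrite -fsm_piD.
have mulpN p : ringpi (FOpp p) = - ringpi p by rewrite -fsm_piN.
have mulpM p q : ringpi (FMul p q) = ringpi p * ringpi q.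
  by rewrite -fsm_piM.
elim/fsm_piW; elim=> [c|||p IHp q IHq|p IHp|p IHp q IHq] x xI.
- split; move: x xI.
  + apply: mspan_additive => [|x y|k r Ir]; rewrite ?mulr0 ?mulrDr //.
    rewrite const_monom; apply: mspan_monom.
    by case: k => *; apply: IMl.
  + apply: mspan_additive => [|x y|k r Ir]; rewrite ?mul0r ?mulrDl //.
    rewrite monom_const; apply: mspan_monom.
    by case: k => *; apply: IMr.
- split; move: x xI.
  + apply: mspan_additive => [|x y|k r Ir]; rewrite ?mulr0 ?mulrDr //.
    rewrite tplus_monom; apply: mspan_monom.
    by case: k => *; [apply: Ia|apply: IMl].
  + apply: mspan_additive => [|x y|k r Ir]; rewrite ?mul0r ?mulrDl //.
    rewrite monom_tplus; apply: mspan_monom.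
    by case: k => * //; apply: Ib.
- split; move: x xI.
  + apply: mspan_additive => [|x y|k r Ir]; rewrite ?mulr0 ?mulrDr //.
    rewrite tminus_monom; apply: mspan_monom.
    by case: k => [[|n]|n] //; apply: Ib.
  + apply: mspan_additive => [|x y|k r Ir]; rewrite ?mul0r ?mulrDl //.
    rewrite monom_tminus; apply: mspan_monom.
    by case: k => [[|n]|n]; [apply: Ia|apply: IMr|apply: Ia].
- rewrite mulpD mulrDl mulrDr; have [? ?] := IHp _ xI; have [? ?] := IHq _ xI.
  by split; apply: mspanD.
- by rewrite mulpN mulNr mulrN; have [? ?] := IHp _ xI; split; apply: mspanN.
- rewrite mulpM; split.
    by rewrite -mulrA; apply: (IHp _ (IHq _ xI).1).1.
  by rewrite mulrA; apply: (IHq _ (IHp _ xI).2).2.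
Qed.

(** The span of all monomials is an ideal, and 1 is a monomial. *)
Lemma mspanT x : mspan setT x.
Proof.
have [_ _ _ /(_ x 1)[]] : two_sided_ideal (mspan setT) by exact: mspan_ideal.
  by rewrite -[1]mulr1; apply: (mspan_monom _ 0).
by rewrite mulr1.
Qed.

Lemma comp_homogeneousMl j k x y : homogeneous j y ->
  comp k (y * x) = y * comp (k - j) x.
Proof.
move=> yj; move: x (mspanT x); apply: mspan_ind => [|x z xE zE|l r _].
- by rewrite mulr0 !comp0 mulr0.
- by rewrite mulrDr !compD xE zE mulrDr.
have yr : homogeneous (j + l) (y * monom l r).
  by apply: homogeneousM => //; exists r.
rewrite (homogeneous_comp _ _ _ yr) comp_monom subr_eq addrC.
by case: ifP; rewrite ?mulr0.
Qed.

Lemma comp_homogeneousMr j k x y : homogeneous j y ->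
  comp k (x * y) = comp (k - j) x * y.
Proof.
move=> yj; move: x (mspanT x); apply: mspan_ind => [|x z xE zE|l r _].
- by rewrite mul0r !comp0 mul0r.
- by rewrite mulrDl !compD xE zE mulrDl.
have yr : homogeneous (l + j) (monom l r * y).
  by apply: homogeneousM => //; exists r.
rewrite (homogeneous_comp _ _ _ yr) comp_monom subr_eq.
by case: ifP; rewrite ?mul0r.
Qed.

(** An element is the sum of its components over the finitely many degrees that
    occur in an expression of it by monomials. *)
Lemma comp_eq0 x : (forall k, comp k x = 0) -> x = 0.
Proof.
have [s _ xE] := mspanT x => x0.
suff <- : \sum_(k <- undup (unzip1 s)) comp k x = x by rewrite big1.
rewrite {1}xE.
under eq_bigr => k _.
  rewrite (big_morph (comp k) (compD k) (comp0 k)).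
  under eq_bigr => kr _ do rewrite comp_monom.
  over.
rewrite exchange_big /= xE big_seq [RHS]big_seq; apply: eq_bigr => kr krs.
rewrite (bigD1_seq kr.1) ?undup_uniq ?mem_undup ?map_f //= eqxx.
by rewrite big1 ?addr0 // => k /negbTE->.
Qed.

Lemma comp_bounded x : exists N : nat, forall k, (N < `|k|)%N -> comp k x = 0.
Proof.
move: x (mspanT x); apply: mspan_ind => [|x y [N xN] [M yM]|k r _].
- by exists 0%N => k _; apply: comp0.
- exists (maxn N M) => k; rewrite gtn_max => /andP[kN kM].
  by rewrite compD xN // yM // addr0.
- exists `|k|%N => j jk; rewrite comp_monom ifN //.
  by apply: contraTneq jk => ->; rewrite ltnn.
Qed.

(** * Central units and inner endomorphisms *)

Lemma comp1 : comp 0 1 = 1.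
Proof. exact: (homogeneous_comp _ _ _ (homogeneous_const 1)). Qed.

Lemma comp1_neq0 k : k != 0 -> comp k 1 = 0.
Proof.
move=> /negPf kN0.
by rewrite (homogeneous_comp _ _ _ (homogeneous_const 1)) kN0.
Qed.

Definition central (z : S) : Prop := forall y, z * y = y * z.

(** The single condition [t' z t = z] is equivalent to commutation with [t] and
    [t'] once [z] commutes with the constants, and it has the advantage that
    [x |-> t' x t] preserves degrees. *)
Lemma central_of_generators z : (forall r, z * iota r = iota r * z) ->
  t' * z * t = z -> central z.
Proof.
move=> zR tzt.
have zt : z * t = t * z.
  rewrite -{2}tzt !mulrA tplus_tminus -zR -mulrA.
  by rewrite const_e_tplus.
have zt' : z * t' = t' * z.
  by rewrite -{1}tzt -mulrA tplus_tminus -mulrA zR mulrA tminus_const_e.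
elim/fsm_piW; elim=> [c|||p IHp q IHq|p IHp|p IHp q IHq].
- exact: zR.
- exact: zt.
- exact: zt'.
- have -> : ringpi (FAdd p q) = ringpi p + ringpi q by rewrite -fsm_piD.
  by rewrite mulrDr mulrDl IHp IHq.
- have -> : ringpi (FOpp p) = - ringpi p by rewrite -fsm_piN.
  by rewrite mulrN mulNr IHp.
- have -> : ringpi (FMul p q) = ringpi p * ringpi q by rewrite -fsm_piM.
  by rewrite mulrA IHp -mulrA IHq mulrA.
Qed.

Lemma central_principal_ideal z : central z ->
  two_sided_ideal [set y | exists s, y = z * s].
Proof.
move=> zC; split=> [|x y [a ->] [b ->]|x [a ->]|r x [a ->]].
- by exists 0; rewrite mulr0.
- by exists (a + b); rewrite mulrDr.
- by exists (- a); rewrite mulrN.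
- split; first by exists (r * a); rewrite mulrA -zC mulrA.
  by exists (a * r); rewrite mulrA.
Qed.

(** The central unit is [v t^n]: it commutes with [r] because
    [v alpha^n(r) = v u r v = r v], and with [t] because the condition on
    [alpha (u r)] amounts to [alpha v = e v]. *)
Lemma inner_central_unit n : inner_with_periodicity alpha n ->
  exists z w, [/\ homogeneous n z, central z & z * w = 1].
Proof.
move=> [u [v [vu alphanE alphauE]]].
have alphav : alpha v = alpha 1 * v.
  have := congr1 (fun r => v * r) (alphauE v); rewrite /= mulrA vu mul1r => <-.
  have -> : u * v = e n by rewrite alphanE mulr1.
  by rewrite -iterS iterSr alphanE !mulrA vu mul1r.
have vE : v * e n.+1 = alpha 1 * v.
  by rewrite iterSr alphanE !mulrA vu mul1r.
exists (monom n v), (t' ^+ n * iota u); split; first by exists v.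
- apply: central_of_generators => [r|].
    rewrite monom_const const_monom; congr (monom _ _).
    by rewrite alphanE !mulrA vu mul1r.
  suff zt : monom n v * t = t * monom n v.
    by rewrite -mulrA zt mulrA tminus_tplus mul1r.
  rewrite monom_tplus tplus_monom alphav -vE.
  have -> : Posz n + 1 = Posz n.+1 by lia.
  exact/esym/(monom_trunc n.+1).
- rewrite /monom -mulrA (mulrA (t ^+ n)) tplusX_tminusX -!rmorphM.
  by rewrite alphanE mulr1 !mulrA vu mul1r vu rmorph1.
Qed.

(** Take [v] and [u] with [z = v t^n] and [z^-1 = t'^n u], both normalized.  The
    component of degree [-n] of any inverse of [z] is again one. *)
Lemma central_unit_inner n z w : homogeneous n.+1 z -> central z ->
  z * w = 1 -> inner_with_periodicity alpha n.+1.
Proof.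
move=> zn zC zw.
have [v [vE zE]] : exists v, v * e n.+1 = v /\ z = iota v * t ^+ n.+1.
  exists (trunc n.+1 (coef z n.+1)); split; first by rewrite -mulrA mul_en.
  rewrite -[RHS]/(monom n.+1 _) monom_trunc -[RHS]/(comp n.+1 z).
  by rewrite (homogeneous_comp _ _ _ zn) eqxx.
have [u [uE zu]] : exists u, e n.+1 * u = u /\ z * (t' ^+ n.+1 * iota u) = 1.
  exists (trunc (Negz n) (coef w (Negz n))).
  split; first by rewrite mulrA mul_en.
  rewrite -[t' ^+ _ * _]/(monom (Negz n) _) monom_trunc.
  have -> : monom (Negz n) (coef w (Negz n)) = comp (0 - Posz n.+1) w.
    by rewrite sub0r -NegzE.
  rewrite -(comp_homogeneousMl _ _ _ _ zn).
  by rewrite zw (homogeneous_comp _ _ _ (homogeneous_const 1)).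
have zv : z * t' ^+ n.+1 = iota v.
  by rewrite zE -mulrA tplusX_tminusX -rmorphM vE.
have tu : t ^+ n.+1 * (t' ^+ n.+1 * iota u) = iota u.
  by rewrite mulrA tplusX_tminusX -rmorphM uE.
have vu : v * u = 1.
  by apply: const_inj; rewrite rmorph1 -zu mulrA zv rmorphM.
have uv : u * v = e n.+1.
  apply: const_inj; rewrite rmorphM /= -tu -zv -mulrA (mulrA _ z) -zC zu mul1r.
  exact: tplusX_tminusX.
(* [z] commutes with [r]; multiply by [t'^n] on the right *)
have vC r : v * alphan n.+1 r = r * v.
  apply: const_inj; rewrite !rmorphM /= -zv -mulrA -const_tminusX mulrA zC.
  by rewrite -mulrA.
(* both sides are [t z t'^n t'], because [z] commutes with [t] *)
have alphav : v * e n.+2 = alpha v.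
  apply: const_inj; rewrite iterSr -[alpha v]mulr_e1 !rmorphM /=.
  rewrite -tplus_tminus mulrA -tplus_const -zv mulrA -zC -!mulrA -(const_tminusX n.+1).
  by rewrite -tplus_tminus -mulrA -exprS exprSr.
have alphau : alpha u = u * alpha 1.
  have := congr1 alpha vu; rewrite alphaM -alphav => /(congr1 (fun r => u * r)).
  rewrite !mulrA uv mul_eSn (iterS _ alpha) -alphaM uE //.
exists u, v; split=> // r; first by rewrite -mulrA -vC mulrA uv mul_en.
by rewrite alphaM alphau -mulrA mul_e1.
Qed.

(** If [1 - z] had an inverse [y], then [y = 1 + z y], so the component of [y] in
    degree [k] is that in degree [k - deg z] multiplied by [z], plus 1 if [k = 0].
    Starting from far below, where [y] vanishes, the components in degrees
    [m deg z] are [z^m], which contradicts the finiteness of the support. *)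
Lemma simple_no_central_unit n z w : simple_ring S -> homogeneous n.+1 z ->
  central z -> z * w = 1 -> False.
Proof.
move=> [[x xN0] Ssimple] zn zC zw.
have nz1 : 1 <> 0 :> S.
  by move=> H; move/eqP: xN0; apply; rewrite -[x]mulr1 H mulr0.
have zC1 : central (1 - z) by move=> y; rewrite mulrBl mulrBr mul1r mulr1 zC.
have [I0|IT] := Ssimple _ (central_principal_ideal _ zC1).
  have : [set 0 : S] (1 - z) by rewrite -I0; exists 1; rewrite mulr1.
  move=> /subr0_eq z1; have := comp1.
  by rewrite {1}z1 (homogeneous_comp _ _ _ zn) => /esym/nz1.
have [y yE] : [set y | exists s, y = (1 - z) * s] 1 by rewrite IT.
have {yE} yE : y = 1 + z * y by rewrite {1}yE mulrBl mul1r subrK.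
have compy k : comp k y = comp k 1 + z * comp (k - n.+1%:Z) y.
  by rewrite {1}yE compD (comp_homogeneousMl _ _ _ _ zn).
have [N yN] := comp_bounded y.
have compy_neg m : comp (- n.+1%:Z) y = z ^+ m * comp (- (n.+1 * m.+1)%N%:Z) y.
  elim: m => [|m IHm]; first by rewrite muln1 mul1r.
  rewrite IHm compy comp1_neq0; last by lia.
  rewrite add0r mulrA -exprSr; congr (_ * comp _ y); lia.
have compy_pos m : comp (n.+1 * m)%N%:Z y = z ^+ m.
  elim: m => [|m IHm].
    rewrite muln0 compy comp1 sub0r (compy_neg N) yN ?mulr0 ?addr0 //.
    by rewrite abszN absz_nat; nia.
  rewrite compy comp1_neq0; last by lia.
  rewrite add0r; have -> : (n.+1 * m.+1)%N%:Z - n.+1%:Z = (n.+1 * m)%N by lia.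
  by rewrite IHm exprS.
have zXN0 m : z ^+ m <> 0.
  elim: m => [//|m IHm H]; apply: IHm.
  by rewrite -[LHS]mul1r -zw zC -mulrA -exprS H mulr0.
apply: (zXN0 N.+1); rewrite -compy_pos yN // absz_nat; nia.
Qed.

(** * Ideals of the ring and invariant ideals *)

(** [alpha r] and [beta r] are obtained from [r] inside [S], as [t r t'] and
    [t' r t]. *)
Lemma contraction_ideal (J : set S) : two_sided_ideal J ->
  two_sided_ideal [set r | J (iota r)] /\
  strongly_invariant alpha [set r | J (iota r)].
Proof.
move=> [J0 JD JN JM].
have JMl c x : J x -> J (c * x) by move=> /(JM c)[].
have JMr c x : J x -> J (x * c) by move=> /(JM c)[].
have Jideal : two_sided_ideal [set r | J (iota r)].
  split=> [|x y Jx Jy|x Jx|r x Jx] /=; rewrite ?rmorph0 ?rmorphD ?rmorphN //.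
  - exact: JD.
  - exact: JN.
  - by rewrite !rmorphM; apply: JM.
split=> //; apply/strongly_invariantP => //; split=> r /= Jr.
  have -> : iota (alpha r) = t * iota r * t'.
    by rewrite tplus_const -mulrA tplus_tminus -rmorphM mulr_e1.
  exact/JMr/JMl.
by rewrite -tminus_const_tplus; apply/JMr/JMl.
Qed.

(** The coefficient of degree 0 maps the span of the monomials over [I] into [I]. *)
Lemma mspan_const (I : set R) r : two_sided_ideal I ->
  mspan I (iota r) -> I r.
Proof.
move=> [I0 ID _ IM] rI.
have -> : r = coef (iota r) 0 by rewrite coef_const.
move: (iota r) rI; apply: mspan_ind => [|x y|k s Is].
- by rewrite coef0.
- by rewrite coefD; apply: ID.
- rewrite coef_monom /single; case: eqP => // _.
  by case: k => n; [apply: (IM _ _ Is).2|apply: (IM _ _ Is).1].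
Qed.

Lemma simple_strongly_invariant : simple_ring S ->
  forall I : set R, two_sided_ideal I -> strongly_invariant alpha I ->
    I = [set 0] \/ I = [set: R].
Proof.
move=> [_ Ssimple] I Iideal /(strongly_invariantP _ Iideal)[Ia Ib].
have [I0 _ _ _] := Iideal.
have [E|E] := Ssimple _ (mspan_ideal _ Iideal Ia Ib); [left|right].
  apply/seteqP; split=> [r Ir|r -> //].
  have : mspan I (iota r) by rewrite -monom0r; apply: mspan_monom.
  by rewrite E => /= r0; apply: const_inj; rewrite r0 rmorph0.
by apply/seteqP; split=> // r _; apply: mspan_const; rewrite // E.
Qed.

(** * Elements of minimal support in an ideal *)

Definition supp_in (a b : int) (x : S) : Prop :=
  forall k, ~~ (a <= k <= b) -> comp k x = 0.

Lemma homogeneous_tplusX (n : nat) : homogeneous n (t ^+ n).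
Proof. by exists 1; rewrite /monom rmorph1 mul1r. Qed.

Lemma homogeneous_tminusX (n : nat) : homogeneous (- n%:Z) (t' ^+ n).
Proof.
by case: n => [|n]; exists 1; rewrite /= ?rmorph1 ?mulr1.
Qed.

Lemma comp_constMl k r x : comp k (iota r * x) = iota r * comp k x.
Proof. by rewrite (comp_homogeneousMl _ _ _ _ (homogeneous_const r)) subr0. Qed.

Lemma comp_constMr k r x : comp k (x * iota r) = comp k x * iota r.
Proof. by rewrite (comp_homogeneousMr _ _ _ _ (homogeneous_const r)) subr0. Qed.

Lemma comp_tplus_tminus k x : comp k (t * x * t') = t * comp k x * t'.
Proof.
rewrite (comp_homogeneousMr _ _ _ _ (homogeneous_tminusX 1)).
by rewrite (comp_homogeneousMl _ _ _ _ (homogeneous_tplusX 1)) opprK addrK.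
Qed.

Lemma comp_tminus_tplus k x : comp k (t' * x * t) = t' * comp k x * t.
Proof.
rewrite (comp_homogeneousMr _ _ _ _ (homogeneous_tplusX 1)).
by rewrite (comp_homogeneousMl _ _ _ _ (homogeneous_tminusX 1)) opprK subrK.
Qed.

(** Right multiplication by [t'] and left multiplication by [t] are injective, as
    [t' t = 1]; they move the support down and up respectively. *)
Lemma shift_nonneg (J : set S) a d x : two_sided_ideal J -> J x -> x <> 0 ->
  supp_in a (a + d) x -> exists x', [/\ J x', x' <> 0 & supp_in 0 d x'].
Proof.
move=> [_ _ _ JM] Jx xN0 xs; case: a xs => n xs.
  exists (x * t' ^+ n); split; first exact: (JM _ _ Jx).2.
    move=> H; apply: xN0.
    by rewrite -[x]mulr1 -(tminusX_tplusX n) mulrA H mul0r.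
  move=> k kd; rewrite (comp_homogeneousMr _ _ _ _ (homogeneous_tminusX n)).
  by rewrite xs ?mul0r //; lia.
exists (t ^+ n.+1 * x); split; first exact: (JM _ _ Jx).1.
  move=> H; apply: xN0.
  by rewrite -[x]mul1r -(tminusX_tplusX n.+1) -mulrA H mulr0.
move=> k kd; rewrite (comp_homogeneousMl _ _ _ _ (homogeneous_tplusX n.+1)).
by rewrite xs ?mulr0 //; lia.
Qed.

(** The bound [a + d - 1] makes the support one degree narrower than the minimal
    one; for [d = 0] it is empty. *)
Lemma minimal_support (J : set S) x : two_sided_ideal J -> J x -> x <> 0 ->
  exists d : nat, (exists x', [/\ J x', x' <> 0 & supp_in 0 d x']) /\
    forall a y, J y -> supp_in a (a + d%:Z - 1) y -> y = 0.
Proof.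
move=> Jideal Jx xN0.
pose P d := `[< exists x', [/\ J x', x' <> 0 & supp_in 0 (Posz d) x'] >].
have exP : exists d, P d.
  have [N xN] := comp_bounded x; exists (N + N)%N; apply/asboolP.
  apply: (shift_nonneg _ (- N%:Z) _ x) => // k kN; apply: xN; lia.
have [d /asboolP Pd dmin] := ex_minnP exP.
exists d; split=> // a y Jy ys; apply: contrapT => yN0.
case: d Pd dmin ys => [|d] Pd dmin ys.
  by apply: yN0; apply: comp_eq0 => k; apply: ys; lia.
suff /dmin : P d by rewrite ltnn.
apply/asboolP; apply: (shift_nonneg _ a _ y) => //.
by have -> : a + d%:Z = a + d.+1%:Z - 1 by lia.
Qed.

(** * Simplicity from outerness and trivial invariant ideals *)

Section Converse.

Hypothesis alpha_outer : outer alpha.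
Hypothesis R_invariant_simple : forall I : set R,
  two_sided_ideal I -> strongly_invariant alpha I ->
  I = [set 0] \/ I = [set: R].

Lemma nonzero_invariant_ideal_contains_1 (I : set R) r : two_sided_ideal I ->
  strongly_invariant alpha I -> I r -> r <> 0 -> I 1.
Proof.
move=> Iideal Iinv Ir rN0.
have [E|->//] := R_invariant_simple _ Iideal Iinv.
by rewrite E in Ir.
Qed.

(** The ideal [z S] contains the constant [z t'^n], which is the normalized
    coefficient of [z] and therefore nonzero; so the contraction of [z S] to [R]
    contains 1. *)
Lemma invertible_central_homogeneous (n : nat) z :
  homogeneous n z -> central z -> z <> 0 -> exists w, z * w = 1.
Proof.
move=> [a zE] zC zN0.
have [Kideal Kinv] := contraction_ideal _ (central_principal_ideal _ zC).
have Kr : z * t' ^+ n = iota (a * e n).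
  by rewrite zE -mulrA tplusX_tminusX -rmorphM.
have rN0 : a * e n <> 0.
  move=> H; apply: zN0; rewrite zE -monom_trunc /trunc H.
  exact: monom0.
have [|w] := nonzero_invariant_ideal_contains_1 _ (a * e n) Kideal Kinv _ rN0.
  by exists (t' ^+ n); rewrite Kr.
by exists w.
Qed.

(** The components of degree 0 of the elements of [J] supported in degrees
    [0 .. d] form an ideal [L] of [R], strongly invariant because [t y t'] and
    [t' y t] have the same support bounds as [y].  Minimality of the width makes
    [L] nonzero, so [L] contains 1. *)
Lemma normalized_element (J : set S) x (d : nat) : two_sided_ideal J ->
  J x -> x <> 0 -> supp_in 0 d x ->
  (forall a y, J y -> supp_in a (a + d%:Z - 1) y -> y = 0) ->
  exists x', [/\ J x', supp_in 0 d x' & comp 0 x' = 1].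
Proof.
move=> [J0 JD JN JM] Jx xN0 xs dmin.
have JMl c y : J y -> J (c * y) by move=> /(JM c)[].
have JMr c y : J y -> J (y * c) by move=> /(JM c)[].
pose L := [set r | exists y, [/\ J y, supp_in 0 d y & comp 0 y = iota r]].
have Lideal : two_sided_ideal L.
  split=> [|r s [y [Jy ys yr]] [y' [Jy' y's y'r]]|r [y [Jy ys yr]]
            |c r [y [Jy ys yr]]].
  - exists 0; split=> [//|k _|]; first exact: comp0.
    by rewrite rmorph0; apply: comp0.
  - exists (y + y'); split; [exact: JD| |by rewrite compD yr y'r rmorphD].
    by move=> k kd; rewrite compD ys ?y's ?addr0.
  - exists (- y); split; [exact: JN| |by rewrite compN yr rmorphN].
    by move=> k kd; rewrite compN ys ?oppr0.
  - split.
      exists (iota c * y); split; first exact: JMl.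
        by move=> k kd; rewrite comp_constMl ys ?mulr0.
      by rewrite comp_constMl yr rmorphM.
    exists (y * iota c); split; first exact: JMr.
      by move=> k kd; rewrite comp_constMr ys ?mul0r.
    by rewrite comp_constMr yr rmorphM.
have Linv : strongly_invariant alpha L.
  apply/strongly_invariantP => //; split=> r [y [Jy ys yr]].
    exists (t * y * t'); split; first exact/JMr/JMl.
      by move=> k kd; rewrite comp_tplus_tminus ys ?mulr0 ?mul0r.
    rewrite comp_tplus_tminus yr tplus_const -mulrA tplus_tminus -rmorphM.
    by rewrite mulr_e1.
  exists (t' * y * t); split; first exact/JMr/JMl.
    by move=> k kd; rewrite comp_tminus_tplus ys ?mulr0 ?mul0r.
  by rewrite comp_tminus_tplus yr tminus_const_tplus.
have x0E : comp 0 x = iota (coef x 0) by rewrite /comp monom0r.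
have [||x' [Jx' x's x'0]] :=
  nonzero_invariant_ideal_contains_1 _ (coef x 0) Lideal Linv.
- by exists x.
- move=> r0; apply/xN0/(dmin 1) => // k kd.
  have [->|k0] := eqVneq k 0; first by rewrite x0E r0 rmorph0.
  by apply: xs; lia.
- by exists x'; rewrite x'0 rmorph1.
Qed.

(** The top component [z] of a normalized element of minimal width is central,
    since the differences [y r - r y] and [t' y t - y] belong to [J] and have lost
    their component of degree 0.  It is also invertible, which outerness excludes
    unless its degree is 0. *)
Lemma nonzero_ideal_contains_1 (J : set S) x : two_sided_ideal J ->
  J x -> x <> 0 -> J 1.
Proof.
move=> Jideal Jx xN0.
have [d [[{Jx xN0}x [Jx xN0 xs]] dmin]] := minimal_support _ _ Jideal Jx xN0.
have one_N0 : 1 <> 0 :> S by move=> H; apply: xN0; rewrite -[x]mulr1 H mulr0.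
have {xN0 xs Jx}[y [Jy ys y0]] :=
  normalized_element _ _ _ Jideal Jx xN0 xs dmin.
case: d ys dmin => [|d] ys dmin.
  suff <- : y = 1 by [].
  apply/subr0_eq/comp_eq0 => k; rewrite compD compN.
  have [->|k0] := eqVneq k 0; first by rewrite y0 comp1 subrr.
  by rewrite comp1_neq0 // subr0 ys //; lia.
have [_ JD JN JM] := Jideal.
have narrow_eq0 y' : J y' -> supp_in 0 d.+1 y' -> comp 0 y' = 0 -> y' = 0.
  move=> Jy' y's y'0; apply: (dmin 1) => // k kd.
  by have [->//|k0] := eqVneq k 0; apply: y's; lia.
pose z := comp d.+1 y.
have zn : homogeneous d.+1 z by exact: comp_homogeneous.
have zR r : z * iota r = iota r * z.
  rewrite -comp_constMr -comp_constMl; congr (comp _ _).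
  apply/subr0_eq/narrow_eq0.
  - apply: JD; [exact: (JM _ _ Jy).2|exact/JN/(JM _ _ Jy).1].
  - move=> k kd; rewrite compD compN comp_constMl comp_constMr ys //.
    by rewrite mul0r mulr0 subr0.
  - rewrite compD compN comp_constMl comp_constMr y0.
    by rewrite mul1r mulr1 subrr.
have zt : t' * z * t = z.
  rewrite -comp_tminus_tplus; congr (comp _ _); apply/subr0_eq/narrow_eq0.
  - apply: JD; [exact/(JM _ _ _).2/(JM _ _ Jy).1|exact/JN].
  - move=> k kd; rewrite compD compN comp_tminus_tplus ys //.
    by rewrite mulr0 mul0r subr0.
  - rewrite compD compN comp_tminus_tplus y0 mulr1 tminus_tplus.
    exact: subrr.
have zN0 : z <> 0.
  move=> z0; apply: one_N0; rewrite -y0.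
  suff -> : y = 0 by exact: comp0.
  apply: (dmin 0) => // k kd.
  by have [->//|kd'] := eqVneq k d.+1; apply: ys; lia.
have zC := central_of_generators z zR zt.
have [w zw] := invertible_central_homogeneous _ _ zn zC zN0.
by case: (alpha_outer d.+1 isT (central_unit_inner _ _ _ zn zC zw)).
Qed.

End Converse.

End CornerEndomorphism.

(** * The equivalence *)

(** [e] is [alpha x] for some [x], so [alpha 1] is a left unit for it; as [alpha 1]
    is in the corner, [e] is a right unit for [alpha 1]. *)
Lemma corner_unit (R : pzRingType) (alpha : {additive R -> R}) (e : R) :
  {morph alpha : x y / x * y} -> e * e = e ->
  range alpha = [set e * r * e | r in [set: R]] -> e = alpha 1.
Proof.
move=> alphaM e_idem alpha_range.
have [x _ xE] : range alpha e.
  by rewrite alpha_range; exists e; rewrite ?e_idem.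
have [r _ rE] : [set e * r * e | r in [set: R]] (alpha 1).
  by rewrite -alpha_range; exists 1.
by rewrite -{1}xE -[x]mul1r alphaM xE -rE -mulrA e_idem.
Qed.

Theorem corollary9p8 (R : pzRingType) (alpha : {additive R -> R}) (e : R)
  (alphaM : {morph alpha : x y / x * y})
  (alpha_inj : injective alpha)
  (e_idem : e * e = e)
  (alpha_range : range alpha = [set e * r * e | r in [set: R]]) :
  simple_ring (fsm_ring alpha e) <->
  (outer alpha /\
   forall I : set R, two_sided_ideal I -> strongly_invariant alpha I ->
     I = [set 0] \/ I = [set: R]).
Proof.
have e1 := corner_unit _ _ _ alphaM e_idem alpha_range; subst e.
have /choice[beta betaE] : forall r, exists s, alpha s = alpha 1 * r * alpha 1.
  move=> r; have [s _ <-] : range alpha (alpha 1 * r * alpha 1).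
    by rewrite alpha_range; exists r.
  by exists s.
split=> [Ssimple|[alpha_outer Rsimple]].
  split; last exact: (simple_strongly_invariant _ _ beta).
  case=> [//|n] _ /(inner_central_unit _ _ beta alphaM)[] // z [w [zn zC zw]].
  exact: (simple_no_central_unit _ _ beta alphaM _ _ _ _ _ Ssimple zn zC zw).
split.
  exists 1; apply/eqP => one0; apply: (alpha_outer 1%N isT).
  (* over the zero ring the identity is inner, with [u = v = 0] *)
  have R0 (r : R) : r = 0.
    rewrite -[r]mul1r; have -> : 1 = 0 :> R; last exact: mul0r.
    by apply: (const_inj _ _ beta alphaM _ betaE); rewrite // rmorph0 -one0.
  by exists 0, 0; split=> *; rewrite [LHS]R0 [RHS]R0.
move=> J Jideal; have [J0 _ _ JM] := Jideal.
have [[x Jx xN0]|Jno] := pselect (exists2 x, J x & x <> 0); [right|left].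
  have J1 := nonzero_ideal_contains_1 _ _ beta alphaM alpha_inj betaE
    alpha_outer Rsimple _ _ Jideal Jx xN0.
  by apply/seteqP; split=> // y _; rewrite -[y]mul1r; apply: (JM _ _ J1).2.
apply/seteqP; split=> [x Jx|x -> //]; apply: contrapT => xN0.
by apply: Jno; exists x.
Qed.
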